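(* Let $P$ be a polytope. The following are equivalent: (i) $P$ is affinely equivalent to a Cartesian product of simplices; (ii) for every family of faces $(F_i)_{i\in I}$ of $P$, \[\mathrm{aff}\Big(\bigcap_{i\in I}F_i\Big)=\bigcap_{i\in I}\mathrm{aff}(F_i).\]
   Context: $\mathrm{aff}(X)$ denotes the affine hull of a subset $X$ of a finite-dimensional real vector space, with the convention $\mathrm{aff}(\emptyset)=\emptyset$. Faces of $P$ include possibly the empty face. *)

(* Defs.v *)
From HB Require Import structures.
From mathcomp Require Import all_boot all_order all_algebra.
From mathcomp Require Import boolp classical_sets reals.
Set Implicit Arguments. Unset Strict Implicit. Unset Printing Implicit Defensive.
Import Order.TTheory GRing.Theory Num.Theory.
Local Open Scope ring_scope.
Local Open Scope classical_set_scope.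

Section Polytopes.
Variable R : realType.

Definition dotv (n : nat) (c x : 'rV[R]_n) : R := \sum_(i < n) c 0 i * x 0 i.

Definition conv_seq (n : nat) (s : seq 'rV[R]_n) : set 'rV[R]_n :=
  [set x | exists w : 'I_(size s) -> R,
     (forall i, 0 <= w i) /\ \sum_(i < size s) w i = 1 /\
     x = \sum_(i < size s) w i *: s`_i].

Definition polytope (n : nat) (P : set 'rV[R]_n) : Prop :=
  exists s : seq 'rV[R]_n, P = conv_seq s.

(* faces: intersections of P with supporting hyperplanes of valid inequalities
   (c = 0, d = 0 gives P itself; c = 0, d = 1 gives the empty face) *)
Definition face (n : nat) (P F : set 'rV[R]_n) : Prop :=
  exists (c : 'rV[R]_n) (d : R),
    (forall x, P x -> dotv c x <= d) /\ F = [set x | P x /\ dotv c x = d].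

(* affine hull: all affine combinations of finitely many points of X;
   aff set0 = set0 *)
Definition aff (n : nat) (X : set 'rV[R]_n) : set 'rV[R]_n :=
  [set x | exists (k : nat) (p : 'I_k -> 'rV[R]_n) (w : 'I_k -> R),
     (forall i, X (p i)) /\ \sum_(i < k) w i = 1 /\
     x = \sum_(i < k) w i *: p i].

(* Product of standard simplices: coordinates 'I_m are partitioned into the
   blocks g^-1(j), j : 'I_k (all nonempty); the set is
   { x >= 0 : sum of coordinates in each block = 1 }, i.e.
   Delta_{|g^-1(0)|-1} x ... x Delta_{|g^-1(k-1)|-1} up to coordinate order. *)
Definition simplex_prod (m k : nat) (g : 'I_m -> 'I_k) : set 'rV[R]_m :=
  [set x | (forall i, 0 <= x 0 i) /\
           (forall j : 'I_k, \sum_(i < m | g i == j) x 0 i = 1)].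

Definition aff_equiv (m n : nat) (Q : set 'rV[R]_m) (P : set 'rV[R]_n) : Prop :=
  exists (A : 'M[R]_(m, n)) (b : 'rV[R]_n),
    (forall x y, Q x -> Q y -> x *m A + b = y *m A + b -> x = y) /\
    [set x *m A + b | x in Q] = P.

Definition is_prod_simplices (n : nat) (P : set 'rV[R]_n) : Prop :=
  exists (m k : nat) (g : 'I_m -> 'I_k),
    (forall j : 'I_k, exists i : 'I_m, g i = j) /\ aff_equiv (simplex_prod g) P.

End Polytopes.

(* Main.v *)
(** In a product of simplices, the affine hull of a nonempty face is cut out of
    the affine hull of the product by the coordinates that vanish on the face; a
    point of such a hull is an affine combination of a relative interior point
    of the face and a small displacement of it, so intersections commute with
    hulls.

    Conversely, describe P inside its affine hull by an irredundant system of
    inequalities l_i >= 0. Affine hulls commuting with intersections forces the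
    linear relations between the l_i that are supported on a nonempty face to
    vanish (P is simple). If B is a minimal set of facets with empty
    intersection, the system l_i = 0 (i in B) is inconsistent on aff P, which
    yields a relation sum_(i in B) lam_i l_i = 1 with all lam_i > 0. Two such
    sets that meet are equal, and every facet lies in one of them: they are the
    blocks of a partition, and the functions lam_i l_i are the coordinates of a
    product of simplices. *)

Require Import Defs.
From HB Require Import structures.
From mathcomp Require Import all_boot all_order all_algebra.
From mathcomp Require Import boolp classical_sets reals.
From mathcomp Require Import ring lra.
Set Implicit Arguments.
Unset Strict Implicit.
Unset Printing Implicit Defensive.
Import Order.TTheory GRing.Theory Num.Theory.
Local Open Scope ring_scope.

(** * Elementary tools: small displacements and partially prescribed linear systems *)

Lemma small_perturbation (R : realFieldType) (m : nat) (a b : 'I_m -> R) :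
  (forall i, 0 < a i \/ 0 <= a i /\ 0 <= b i) ->
  exists2 e, 0 < e & forall i, 0 <= a i + e * b i.
Proof.
move=> ab.
have pick1 i : exists e, 0 < e /\ forall t, 0 < t -> t <= e -> 0 <= a i + t * b i.
  case: (ab i) => [a0|[a0 b0]]; last first.
    by exists 1; split=> // t t0 _; rewrite addr_ge0 // mulr_ge0 // ltW.
  have [b0|b0] := leP 0 (b i).
    by exists 1; split=> // t t0 _; rewrite addr_ge0 ?mulr_ge0 // ltW.
  exists (a i / - b i); split=> [|t t0]; first by rewrite divr_gt0 // oppr_gt0.
  by rewrite ler_pdivlMr ?oppr_gt0 // mulrN; lra.
have /choice[e /all_and2[e0 eP]] := pick1.
exists (\big[Num.min/1]_i e i).
  by elim/big_ind: _ => // x y x0 y0; rewrite lt_min x0.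
move=> i; apply: eP; last exact: bigmin_le.
by elim/big_ind: _ => // x y x0 y0; rewrite lt_min x0.
Qed.

(** Fredholm alternative for the columns in [T]: the matrix [D] masks the other columns, and the
    obstruction is a masked column of the cokernel. *)
Lemma solve_on_subset (F : fieldType) (N m : nat) (C : 'M[F]_(N, m))
    (y : 'rV[F]_m) (T : {set 'I_m}) :
  (exists u : 'rV_N, forall i, i \in T -> (u *m C) 0 i = y 0 i) \/
  (exists mu : 'cV_m, [/\ forall i, i \notin T -> mu i 0 = 0,
     C *m mu = 0 & (y *m mu) 0 0 != 0]).
Proof.
pose D : 'M[F]_m := diag_mx (\row_i (i \in T)%:R).
have DE p (X : 'M_(p, m)) i j : (X *m D) i j = X i j * (j \in T)%:R.
  by rewrite mul_mx_diag !mxE.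
have [/submxP[u yE]|] := boolP (y *m D <= C *m D)%MS.
  left; exists u => i iT; have := congr1 (fun Z : 'rV_m => Z 0 i) yE.
  by rewrite mulmxA !DE iT !mulr1.
rewrite submxE => /matrix0Pn[i0 [j]]; rewrite {i0}[i0]ord1 => jnz.
right; exists (D *m col j (cokermx (C *m D))); split.
- move=> i iT; rewrite mul_diag_mx !mxE (negPf iT) mul0r //.
- by rewrite mulmxA colE mulmxA mulmx_coker mul0mx.
- by rewrite mulmxA colE mulmxA -colE mxE.
Qed.

(** * Irredundant systems of affine inequalities *)

Section AffineSystem.
Variables (R : realFieldType) (N m : nat) (C : 'M[R]_(N, m)) (d : 'rV[R]_m).

Let l (i : 'I_m) (u : 'rV[R]_N) : R := (u *m C + d) 0 i.
Let feasible (u : 'rV[R]_N) : Prop := forall i, 0 <= l i u.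
Let zero_on (T : {set 'I_m}) (u : 'rV[R]_N) : Prop := forall i, i \in T -> l i u = 0.

Let lE i u : l i u = (u *m C) 0 i + d 0 i.
Proof. by rewrite /l mxE. Qed.

(** [mu] kills the linear parts, so this weighted sum does not depend on [u]; relations are
    exploited by evaluating it at well-chosen points. *)
Lemma sum_relation (mu : 'cV[R]_m) (u : 'rV[R]_N) :
  C *m mu = 0 -> \sum_i l i u * mu i 0 = (d *m mu) 0 0.
Proof.
move=> Cmu; transitivity (((u *m C + d) *m mu) 0 0); first by rewrite mxE.
by rewrite mulmxDl -mulmxA Cmu mulmx0 add0r.
Qed.

Lemma l_affine (i : 'I_m) (u v : 'rV[R]_N) (a b : R) :
  a + b = 1 -> l i (a *: u + b *: v) = a * l i u + b * l i v.
Proof.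
move=> ab; rewrite /l mulmxDl -!scalemxAl !mxE -{1}[d 0 i]mul1r -ab; ring.
Qed.

Hypothesis irredundant :
  forall i, exists2 z, l i z < 0 & forall j, j != i -> 0 <= l j z.
(** Commuting of hulls and intersections enters through this hypothesis and the next. As [v] may be
    infeasible, they say that a nonempty flat [l i = 0] meets the polytope, in a face where no [l j]
    vanishes identically unless it does so on the flat. *)
Hypothesis zero_on_feasible : forall T v, zero_on T v ->
  exists2 u, feasible u & zero_on T u.
Hypothesis zero_on_nonzero : forall T j v, zero_on T v -> l j v != 0 ->
  exists u, [/\ feasible u, zero_on T u & l j u != 0].
Hypothesis max_attained :
  forall i, exists2 z, feasible z & forall u, feasible u -> l i u <= l i z.
Hypothesis somewhere_pos : forall i, exists2 z, feasible z & 0 < l i z.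
Hypothesis nonempty : exists u, feasible u.

(** Simplicity of the polytope, by induction on the size of the support of [mu]. No other
    coefficient can have the sign of [mu r], which would make [l r] redundant. *)
Lemma relation_on_face (mu : 'cV[R]_m) (u : 'rV[R]_N) :
  C *m mu = 0 -> feasible u -> (forall i, mu i 0 != 0 -> l i u = 0) -> mu = 0.
Proof.
have [k] := ubnP #|[set i | mu i 0 != 0]|.
elim: k mu => // k IH mu /ltnSE-le_k Cmu fu u0.
have [//|/matrix0Pn[r [j]]] := eqVneq mu 0; rewrite {j}[j]ord1 => mur.
have dmu : (d *m mu) 0 0 = 0.
  rewrite -(sum_relation u Cmu) big1 // => i _.
  by have [->|/u0->] := eqVneq (mu i 0) 0; rewrite ?mulr0 ?mul0r.
have opp_sign j : j != r -> mu r 0 * mu j 0 <= 0.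
  move=> jr; have [->|muj] := eqVneq (mu j 0) 0; first by rewrite mulr0.
  pose T := [set i | mu i 0 != 0] :\ r.
  (* Ask for [l j = 1] and for zeros on the rest of [T]. An obstruction [nu] is a relation on the
     same face with smaller support, so it vanishes by induction, which is absurd. *)
  have [[v vP]|[nu [nuT Cnu nu0]]] :=
      solve_on_subset C (\row_i (i == j)%:R - d) T.
    have vT i : i \in T -> l i v = (i == j)%:R.
      by move=> /vP; rewrite lE => ->; rewrite !mxE subrK.
    have [||w [fw wT wj]] := @zero_on_nonzero (T :\ j) j v.
    - by move=> i; rewrite in_setD1 => /andP[/negPf ij /vT ->]; rewrite ij.
    - by rewrite vT ?eqxx ?oner_eq0 // !inE jr muj.
    have := sum_relation w Cmu; rewrite dmu (bigD1 r) //= (bigD1 j) //=.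
    rewrite big1 => [|i /andP[ir ij]]; last first.
      have [->|mui] := eqVneq (mu i 0) 0; first by rewrite mulr0.
      by rewrite wT ?mul0r // !inE ij ir.
    have wj0 : 0 < l j w by rewrite lt_def wj fw.
    have wr := fw r => eq0.
    suff : l j w * (mu r 0 * mu j 0) <= 0 by rewrite pmulr_rle0.
    have -> : l j w * (mu r 0 * mu j 0) = - (l r w * mu r 0 ^+ 2) by nra.
    by rewrite oppr_le0 mulr_ge0 // sqr_ge0.
  suff nuE : nu = 0 by rewrite nuE mulmx0 mxE eqxx in nu0.
  apply: IH => //.
    apply: leq_trans le_k; rewrite [leqRHS](cardsD1 r) inE mur add1n ltnS.
    apply/subset_leq_card/fintype.subsetP => i; rewrite inE.
    by apply: contraR => /nuT ->.
  move=> i nui; apply: u0; have : i \in T by apply: contraR nui => /nuT ->.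
  by rewrite !inE => /andP[].
have [z zr zj] := irredundant r.
have := sum_relation z Cmu; rewrite dmu (bigD1 r) //= => eq0.
(* So l_r is a nonnegative combination of the other l_j, against irredundancy. *)
have : mu r 0 * \sum_(i | i != r) l i z * mu i 0 <= 0.
  rewrite mulr_sumr; apply: sumr_le0 => i ir.
  by rewrite mulrCA mulr_ge0_le0 ?zj ?opp_sign.
have mu2 : 0 < mu r 0 ^+ 2 by rewrite exprn_even_gt0.
rewrite -(addr0_eq eq0) mulrN oppr_le0 mulrCA -expr2 pmulr_lge0 //.
by rewrite leNgt zr.
Qed.

(* A circuit is a minimal set of facets without a common point. *)
Let nonface : pred {set 'I_m} := fun T => ~~ `[< exists2 u, feasible u & zero_on T u >].
Let circuit (B : {set 'I_m}) := minset nonface B.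

(** [v] need not be feasible: a circuit is inconsistent on the whole parameter space, which is what
    the linear alternative needs. *)
Lemma circuit_empty B v : circuit B -> ~ zero_on B v.
Proof.
by move=> /minsetp /asboolPn h /zero_on_feasible.
Qed.

Lemma circuit_del B i : circuit B -> i \in B ->
  exists2 u, feasible u & zero_on (B :\ i) u.
Proof.
move=> cB iB; apply/asboolP; apply: contraT => nf.
have := minsetinf cB nf (finset.subD1set _ _) => /setP/(_ i).
by rewrite !inE eqxx iB.
Qed.

Lemma circuit_neq0 B : circuit B -> B != finset.set0.
Proof.
move=> cB; apply/eqP => B0; have [u fu] := nonempty.
by apply: (circuit_empty cB (v := u)) => i; rewrite B0 inE.
Qed.

(** Inconsistency on [B] yields a relation with nonzero constant, scaled to 1. At a feasible zero of
    [B :\ i], given by minimality, only the term of [i] survives, hence its sign. *)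
Lemma circuit_relation B : circuit B -> exists mu : 'cV[R]_m,
  [/\ forall i, i \notin B -> mu i 0 = 0, forall i, i \in B -> 0 < mu i 0,
      C *m mu = 0 & (d *m mu) 0 0 = 1].
Proof.
move=> cB; have [[v vP]|[mu [muB Cmu dmu]]] := solve_on_subset C (- d) B.
  by case: (circuit_empty cB (v := v)) => i /vP; rewrite lE => ->; rewrite mxE addNr.
have {}dmu : (d *m mu) 0 0 != 0 by move: dmu; rewrite mulNmx [X in X != 0]mxE oppr_eq0.
have C1 : C *m (((d *m mu) 0 0)^-1 *: mu) = 0 by rewrite -scalemxAr Cmu scaler0.
have d1 : (d *m (((d *m mu) 0 0)^-1 *: mu)) 0 0 = 1.
  by rewrite -scalemxAr mxE mulVf.
have B1 i : i \notin B -> (((d *m mu) 0 0)^-1 *: mu) i 0 = 0.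
  by move=> /muB; rewrite mxE => ->; rewrite mulr0.
exists (((d *m mu) 0 0)^-1 *: mu); split=> // i iB.
have [u fu u0] := circuit_del cB iB.
have := sum_relation u C1; rewrite d1 (bigD1 i) //= big1 ?addr0 => [eq1|j ji].
  have : 0 < l i u * (((d *m mu) 0 0)^-1 *: mu) i 0 by rewrite eq1.
  have [->|nz] := eqVneq (l i u) 0; first by rewrite mul0r ltxx.
  by rewrite pmulr_rgt0 // lt_def nz fu.
have [jB|/B1->] := boolP (j \in B); last by rewrite mulr0.
by rewrite u0 ?mul0r // !inE ji.
Qed.

(* Evaluate both relations at a feasible point where l_j = 0 on B except at i. *)
Lemma circuit_relation_le (B D : {set 'I_m}) (lam mu : 'cV[R]_m) i :
    circuit B -> i \in B -> i \in D ->
    (forall i, i \notin B -> lam i 0 = 0) -> (forall i, i \in B -> 0 < lam i 0) ->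
    C *m lam = 0 -> (d *m lam) 0 0 = 1 ->
    (forall i, i \in D -> 0 < mu i 0) -> (forall i, i \notin D -> mu i 0 = 0) ->
    C *m mu = 0 -> (d *m mu) 0 0 = 1 ->
  mu i 0 <= lam i 0.
Proof.
move=> cB iB iD lamB lam0 Clam dlam mu0 muD Cmu dmu.
have [u fu u0] := circuit_del cB iB.
have := sum_relation u Clam; rewrite dlam (bigD1 i) //= big1 ?addr0 => [lu|j ji].
  have := sum_relation u Cmu; rewrite dmu (bigD1 i) //=.
  have : 0 <= \sum_(j | j != i) l j u * mu j 0.
    apply: sumr_ge0 => j _; have [jD|/muD->] := boolP (j \in D).
      by rewrite mulr_ge0 // ltW // mu0.
    by rewrite mulr0.
  move=> S0 Su; have lmu : l i u * mu i 0 <= l i u * lam i 0 by lra.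
  move: lmu; rewrite ler_pM2l // lt_def fu andbT.
  by apply/eqP => li0; rewrite li0 mul0r in lu; move/eqP: lu; rewrite eq_sym oner_eq0.
have [jB|/lamB->] := boolP (j \in B); last by rewrite mulr0.
by rewrite u0 ?mul0r // !inE ji.
Qed.

(* At a feasible point where l_j = 0 for all j in B except i, the relation of D
   forces l_j = 0 for j in D outside B, once the coefficients of both relations
   are known to agree on i; so the difference of the relations is supported on
   the face of that point. *)
Lemma circuit_disjoint B D i : circuit B -> circuit D -> i \in B -> i \in D -> B = D.
Proof.
move=> cB cD iB iD.
have [lam [lamB lam0 Clam dlam]] := circuit_relation cB.
have [mu [muD mu0 Cmu dmu]] := circuit_relation cD.
have eqBD j : j \in B -> j \in D -> lam j 0 = mu j 0.
  move=> jB jD; apply/eqP; rewrite eq_le.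
  rewrite (circuit_relation_le cB jB jD lamB lam0 Clam dlam mu0 muD Cmu dmu).
  by rewrite (circuit_relation_le cD jD jB muD mu0 Cmu dmu lam0 lamB Clam dlam).
suff E : lam - mu = 0.
  have lm j : lam j 0 = mu j 0 by rewrite (subr0_eq E).
  apply/setP => j; apply/idP/idP => [jB|jD].
    by apply: contraLR (lam0 j jB) => /muD; rewrite -lm => ->; rewrite ltxx.
  by apply: contraLR (mu0 j jD) => /lamB; rewrite lm => ->; rewrite ltxx.
have [u fu u0] := circuit_del cB iB.
apply: (@relation_on_face _ u) => //; first by rewrite mulmxBr Clam Cmu subrr.
have lu : l i u * lam i 0 = 1.
  have := sum_relation u Clam; rewrite dlam (bigD1 i) //= big1 ?addr0 // => j ji.
  have [jB|/lamB->] := boolP (j \in B); last by rewrite mulr0.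
  by rewrite u0 ?mul0r // !inE ji.
have terms_ge0 j : 0 <= l j u * mu j 0.
  have [jD|/muD->] := boolP (j \in D); last by rewrite mulr0.
  by rewrite mulr_ge0 // ltW // mu0.
have rest0 : \sum_(j | j != i) l j u * mu j 0 = 0.
  by have := sum_relation u Cmu; rewrite dmu (bigD1 i) //= -eqBD // lu; lra.
move=> j; rewrite !mxE => nz.
have [jB|jB] := boolP (j \in B).
  apply: u0; rewrite !inE jB andbT; apply: contraNneq nz => ->.
  by rewrite eqBD ?subrr.
have ji : j != i by apply: contraNneq jB => ->.
move: nz; rewrite (lamB j jB) sub0r oppr_eq0 => nz.
have := psumr_eq0P (fun j _ => terms_ge0 j) rest0 ji.
by move/eqP; rewrite mulf_eq0 (negPf nz) orbF => /eqP.
Qed.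

(** Let [z] maximise [l i]. If facet [i] shared a point [y] with all facets through [z], the segment
    from [y] to [z] could be prolonged past [z], increasing [l i]. The resulting circuit contains
    [i], since the other facets meet at [z]. *)
Lemma circuit_cover i : exists2 B, circuit B & i \in B.
Proof.
have [z fz zmax] := max_attained i.
have zi : 0 < l i z by have [w fw w0] := somewhere_pos i; apply: lt_le_trans w0 (zmax _ fw).
pose T := [set k | l k z == 0].
have zT : zero_on T z by move=> k; rewrite inE => /eqP.
have : nonface (i |: T).
  apply/asboolPn => -[y fy yT].
  have [|e e0 eP] := @small_perturbation R m (l^~ z) (fun k => l k z - l k y).
    move=> k; have [lk|lk] := eqVneq (l k z) 0; last by left; rewrite lt_def lk fz.
    by right; rewrite lk yT ?subrr // !inE lk eqxx orbT.
  have E k : l k ((1 + e) *: z + (- e) *: y) = l k z + e * (l k z - l k y).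
    by rewrite l_affine ?addrK //; ring.
  have /zmax : feasible ((1 + e) *: z + (- e) *: y) by move=> k; rewrite E.
  rewrite E yT ?setU11 // subr0; nra.
move=> /minset_exists[B cB BT]; exists B => //.
apply: contraT => iB; case: (circuit_empty cB (v := z)) => j jB.
apply: zT; have := fintype.subsetP BT j jB; rewrite in_setU1 => /orP[/eqP ji|//].
by rewrite -ji jB in iB.
Qed.

(** The blocks are the circuits and [lam] collects the coefficients of their relations. The last
    clause holds because these relations span any obstruction to solving for [u]. *)
Lemma simplex_coordinates : exists (k : nat) (g : 'I_m -> 'I_k) (lam : 'I_m -> R),
  [/\ forall j, exists i, g i = j, forall i, 0 < lam i,
      forall u j, \sum_(i | g i == j) lam i * l i u = 1 &
      forall y : 'I_m -> R, (forall j, \sum_(i | g i == j) y i = 1) ->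
        exists u, forall i, lam i * l i u = y i].
Proof.
pose BB := [set B | circuit B]; pose blk (j : 'I_#|BB|) := enum_val j.
have blkP j : circuit (blk j) by have := enum_valP j; rewrite inE.
have /choice[g gP] : forall i, exists j : 'I_#|BB|, i \in blk j.
  move=> i; have [B cB iB] := circuit_cover i.
  have BBB : B \in BB by rewrite inE.
  by exists (enum_rank_in BBB B); rewrite /blk enum_rankK_in.
have gE i j : (g i == j) = (i \in blk j).
  apply/eqP/idP => [<- //|ij]; apply: enum_val_inj.
  exact: circuit_disjoint (blkP _) (blkP _) (gP i) ij.
have /choice[L LP] : forall j, exists mu : 'cV[R]_m,
  [/\ forall i, i \notin blk j -> mu i 0 = 0, forall i, i \in blk j -> 0 < mu i 0,
      C *m mu = 0 & (d *m mu) 0 0 = 1] by move=> j; exact: circuit_relation.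
have LE j (F : 'I_m -> R) : \sum_i F i * L j i 0 = \sum_(i | g i == j) F i * L (g i) i 0.
  rewrite [LHS](bigID (fun i => g i == j)) /= [X in _ + X]big1 ?addr0.
    by apply: eq_bigr => i /eqP->.
  by move=> i; rewrite gE; case: (LP j) => L0 _ _ _ /L0 ->; rewrite mulr0.
have lam0 i : 0 < L (g i) i 0 by case: (LP (g i)) => _ + _ _; apply.
have /choice[t tP] : forall j, exists i, g i = j.
  by move=> j; have /finset.set0Pn[i] := circuit_neq0 (blkP j); rewrite -gE => /eqP; exists i.
exists _, g, (fun i => L (g i) i 0); split=> //.
- by move=> j; exists (t j).
- move=> u j; have [_ _ CL <-] := LP j; rewrite -(sum_relation u CL) LE.
  by apply: eq_bigr => i _; rewrite mulrC.
move=> y ysum.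
have [[u uP]|[mu [_ Cmu]]] := solve_on_subset C (\row_i (y i / L (g i) i 0) - d) [set: 'I_m].
  exists u => i; rewrite lE uP ?inE // !mxE.
  by rewrite subrK mulrCA mulfV ?mulr1 ?gt_eqF.
case/negP; apply/eqP.
pose c j := mu (t j) 0 / L j (t j) 0.
suff muE : mu = \sum_j c j *: L j.
  rewrite muE mulmx_sumr summxE big1 // => j _.
  rewrite -scalemxAr mulmxBl !mxE; have [_ _ _ dL] := LP j.
  rewrite mxE in dL; rewrite dL; under eq_bigr do rewrite mxE.
  rewrite LE; under eq_bigr do rewrite divfK ?gt_eqF //.
  by rewrite ysum subrr mulr0.
apply/eqP; rewrite -subr_eq0; apply/eqP.
(* The coefficients [c j] cancel [mu] at the representatives [t j]. [T] omits one element of each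
   circuit, so it contains none and has a common feasible zero. *)
pose T := [set i | i != t (g i)].
have : ~~ nonface T.
  apply/negP => /minset_exists[B cB BT].
  have BBB : B \in BB by rewrite inE.
  have : t (enum_rank_in BBB B) \in B.
    have /eqP := tP (enum_rank_in BBB B); rewrite gE.
    by rewrite /blk enum_rankK_in.
  by move/(fintype.subsetP BT); rewrite inE tP eqxx.
move/negPn/asboolP => -[u fu uT].
apply: (@relation_on_face _ u) => //.
  rewrite mulmxBr Cmu mulmx_sumr big1 ?subrr // => j _.
  by rewrite -scalemxAr; have [_ _ -> _] := LP j; rewrite scaler0.
move=> i nz; apply: uT; rewrite inE; apply: contraNneq nz => it.
rewrite !mxE summxE (bigD1 (g i)) //= big1 ?addr0 => [|j ji].
  by rewrite mxE /c -it divfK ?subrr // gt_eqF.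
have [L0 _ _ _] := LP j; rewrite mxE L0 ?mulr0 //.
by rewrite -gE eq_sym.
Qed.

End AffineSystem.

(** * Halfspaces, affine and convex hulls, faces *)

Section HalfspaceRepresentation.
Variable R : realType.

(** Recursive on the generators, so that elimination can remove them one by one; [cone_map] recovers
    the form with weights. *)
Fixpoint cone (n : nat) (s : seq 'rV[R]_n) (x : 'rV[R]_n) : Prop :=
  if s is a :: s' then exists2 t, 0 <= t & cone s' (x - t *: a) else x = 0.

Lemma cone_map (n n' : nat) (f : 'rV[R]_n -> 'rV[R]_n') (s : seq 'rV[R]_n) x :
  cone (map f s) x <-> exists w : 'I_(size s) -> R,
    (forall i, 0 <= w i) /\ x = \sum_i w i *: f s`_i.
Proof.
elim: s x => [|a s IH] x /=.
  split=> [->|[w [_ ->]]]; last by rewrite big_ord0.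
  by exists (fun=> 0); split=> //; rewrite big_ord0.
split=> [[t t0 /IH[w [w0 xE]]]|[w [w0 ->]]].
  exists (fun i => if unlift ord0 i is Some j then w j else t); split.
    by move=> i; case: unliftP.
  rewrite big_ord_recl unlift_none /=.
  under eq_bigr do rewrite liftK.
  by rewrite -[x](subrK (t *: f a)) xE addrC.
exists (w ord0) => //; apply/IH; exists (fun i => w (lift ord0 i)); split=> //.
by rewrite big_ord_recl /= addrC addKr.
Qed.

(* Fourier-Motzkin elimination of the coefficient of one generator at a time. *)
Lemma cone_halfspaces (n : nat) (s : seq 'rV[R]_n) :
  exists L : seq 'cV[R]_n, forall x, cone s x <-> forall c, c \in L -> 0 <= (x *m c) 0 0.
Proof.
elim: s => [|a s [L LP]] /=.
  exists ([seq delta_mx i 0 | i <- enum 'I_n] ++ [seq - delta_mx i 0 | i <- enum 'I_n]).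
  move=> x; split=> [-> c _|xL]; first by rewrite mul0mx mxE.
  apply/rowP => i; rewrite [RHS]mxE; apply/eqP; rewrite eq_le; apply/andP; split.
    have := xL (- delta_mx i 0); rewrite mulmxN -colE [X in 0 <= X]mxE mxE oppr_ge0.
    by apply; rewrite mem_cat; apply/orP; right; apply/mapP; exists i; rewrite ?mem_enum.
  have := xL (delta_mx i 0); rewrite -colE mxE.
  by apply; rewrite mem_cat; apply/orP; left; apply/mapP; exists i; rewrite ?mem_enum.
pose phi (c : 'cV[R]_n) (x : 'rV[R]_n) := (x *m c) 0 0.
(* Keep the functionals nonnegative at [a]; combine each negative one with each positive one so that
   the result vanishes at [a]. *)
exists ([seq c <- L | 0 <= phi c a] ++
  [seq phi c' a *: c - phi c a *: c' | c <- [seq c <- L | phi c a < 0],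
                                       c' <- [seq c <- L | 0 < phi c a]]).
have phiB c x t : phi c (x - t *: a) = phi c x - t * phi c a.
  by rewrite /phi mulmxBl -scalemxAl !mxE.
have phiD c c' t t' x : phi (t *: c - t' *: c') x = t * phi c x - t' * phi c' x.
  by rewrite /phi mulmxBr -!scalemxAr !mxE.
move=> x; split=> [[t t0 /LP xL] c|xL].
  have {}xL b : b \in L -> t * phi b a <= phi b x.
    by move/xL; rewrite -/(phi _ _) phiB subr_ge0.
  rewrite -/(phi c x) mem_cat => /orP[|/allpairsP[[b b'] /= [+ + ->]]].
    rewrite mem_filter => /andP[ca /xL]; apply: le_trans; exact: mulr_ge0.
  rewrite !mem_filter phiD => /andP[ba /xL bx] /andP[b'a /xL b'x].
  nra.
have {xL} [xpos xpair] :
    (forall c, c \in L -> 0 <= phi c a -> 0 <= phi c x) /\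
    (forall c c', c \in L -> c' \in L -> phi c a < 0 -> 0 < phi c' a ->
       phi c x / phi c a <= phi c' x / phi c' a).
  split=> [c cL ca|c c' cL c'L ca c'a].
    by apply: xL; rewrite mem_cat mem_filter ca cL.
  rewrite ler_pdivlMr // mulrAC ler_ndivrMr // -subr_ge0.
  have := xL (phi c' a *: c - phi c a *: c').
  rewrite -/(phi _ _) phiD => h; rewrite mulrC [_ * phi c a]mulrC; apply: h.
  rewrite mem_cat; apply/orP; right; apply/allpairsP; exists (c, c') => /=.
  by rewrite !mem_filter ca c'a.
(* The least [t >= 0] allowed by the functionals negative at [a]; those positive at [a] bound [t]
   from above. *)
pose t := \big[Num.max/0]_(c <- [seq c <- L | phi c a < 0]) (phi c x / phi c a).
have t0 : 0 <= t by rewrite /t; exact: bigmax_ge_id.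
exists t => //; apply/LP => c cL; rewrite -/(phi _ _) phiB subr_ge0.
case: (ltrgtP (phi c a) 0) => [ca|ca|ca].
- rewrite -ler_ndivrMr //; apply: (@le_bigmax_seq _ _ _ _ _ c xpredT (fun c => phi c x / phi c a)) => //.
  by rewrite mem_filter ca.
- rewrite -ler_pdivlMr // /t big_seq; apply: bigmax_le.
    by rewrite divr_ge0 ?xpos // ltW.
  by move=> b; rewrite mem_filter => /andP[ba bL]; exact: xpair.
- by rewrite ca mulr0 xpos // ca.
Qed.

(** Homogenisation: the hull is the slice at height 1 of the cone over the lifted points, and the
    first entry of each functional becomes a constant term. *)
Lemma conv_seq_halfspaces (n : nat) (s : seq 'rV[R]_n) :
  exists m (M : 'M[R]_(n, m)) (e : 'rV[R]_m),
    forall x, conv_seq s x <-> forall i, 0 <= (x *m M + e) 0 i.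
Proof.
pose f (v : 'rV[R]_n) : 'rV[R]_(1 + n) := row_mx 1%:M v.
have [L LP] := cone_halfspaces (map f s).
have fE (w : 'I_(size s) -> R) :
    \sum_i w i *: f s`_i = row_mx (\sum_i w i)%:M (\sum_i w i *: s`_i).
  apply/rowP => j; rewrite -[j]splitK summxE; case: (fintype.split j) => k /=.
    rewrite row_mxEl [k]ord1 mxE eqxx; apply: eq_bigr => i _.
    by rewrite mxE row_mxEl mxE eqxx mulr1.
  rewrite row_mxEr summxE; apply: eq_bigr => i _.
  by rewrite [LHS]mxE row_mxEr [RHS]mxE.
exists (size L), (\matrix_(a, i) (L`_i : 'cV[R]_(1 + n)) (rshift 1 a) 0).
exists (\row_i (L`_i : 'cV[R]_(1 + n)) (lshift n 0) 0) => x.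
have cE c : (f x *m c) 0 0 = c (lshift n 0) 0 + \sum_a x 0 a * c (rshift 1 a) 0.
  rewrite -{1}[c]vsubmxK mul_row_col mul1mx !mxE; congr (_ + _).
  by apply: eq_bigr => a _; rewrite mxE.
have iE (i : 'I_(size L)) : (x *m (\matrix_(a, i) (L`_i : 'cV[R]_(1 + n)) (rshift 1 a) 0)
    + \row_i (L`_i : 'cV[R]_(1 + n)) (lshift n 0) 0) 0 i = (f x *m L`_i) 0 0.
  rewrite cE addrC !mxE; congr (_ + _).
  by apply: eq_bigr => a _; rewrite mxE.
transitivity (cone (map f s) (f x)).
  rewrite cone_map; split=> [[w [w0 [w1 ->]]]|[w [w0]]].
    by exists w; split=> //; rewrite fE w1.
  rewrite fE => /eq_row_mx[w1 ->]; exists w; split=> //; split=> //.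
  by have := congr1 (fun Z : 'M_1 => Z 0 0) w1; rewrite !mxE eqxx.
rewrite LP; split=> [xL i|xL c cL]; first by rewrite iE xL // mem_nth.
have := xL (Ordinal (eq_ind_r is_true cL (index_mem c L))).
by rewrite iE /= nth_index.
Qed.

End HalfspaceRepresentation.

Local Open Scope classical_set_scope.

Section AffineHull.
Variable R : realType.

Lemma aff_sub (n : nat) (X : set 'rV[R]_n) x : X x -> aff X x.
Proof.
move=> Xx; exists 1%N, (fun=> x), (fun=> 1); split=> //.
by rewrite !big_ord1 scale1r.
Qed.

Lemma aff_mono (n : nat) (X Y : set 'rV[R]_n) : X `<=` Y -> aff X `<=` aff Y.
Proof. by move=> XY x [k [p [w [pX h]]]]; exists k, p, w; split=> // i; exact: XY. Qed.

Lemma aff_line (n : nat) (X : set 'rV[R]_n) x y (a b : R) :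
  X x -> X y -> a + b = 1 -> aff X (a *: x + b *: y).
Proof.
move=> Xx Xy ab; exists 2%N, (fun i => if i == ord0 then x else y).
exists (fun i => if i == ord0 then a else b); split; first by move=> i; case: ifP.
by rewrite !big_ord_recl !big_ord0 /= !addr0.
Qed.

Lemma aff_nonempty (n : nat) (X : set 'rV[R]_n) x : aff X x -> exists y, X y.
Proof.
move=> [[|k] [p [w [pX [w1 _]]]]]; last by exists (p ord0).
by move/eqP: w1; rewrite big_ord0 eq_sym oner_eq0.
Qed.

Lemma aff_coord (n p : nat) (X : set 'rV[R]_n) (M : 'M[R]_(n, p)) (j : 'I_p) (e : R) x :
  (forall y, X y -> (y *m M) 0 j = e) -> aff X x -> (x *m M) 0 j = e.
Proof.
move=> XM [k [q [w [qX [w1 ->]]]]].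
rewrite mulmx_suml summxE; under eq_bigr do rewrite -scalemxAl mxE XM //.
by rewrite -mulr_suml w1 mul1r.
Qed.

Lemma aff_image (m n : nat) (A : 'M[R]_(m, n)) (b : 'rV[R]_n) (Y : set 'rV[R]_m) v :
  aff [set y *m A + b | y in Y] v -> exists2 y, aff Y y & y *m A + b = v.
Proof.
move=> [k [p [w [pX [w1 ->]]]]].
have /choice[q /all_and2[qY qp]] : forall i, exists y, Y y /\ y *m A + b = p i.
  by move=> i; have [y] := pX i; exists y.
exists (\sum_i w i *: q i); first by exists k, q, w.
rewrite mulmx_suml -{1}[b]scale1r -w1 scaler_suml -big_split /=.
by apply: eq_bigr => i _; rewrite -qp -scalemxAl scalerDr.
Qed.

End AffineHull.

(** * Convex hulls of finite sequences and parameters on their affine hulls *)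

Section ConvexHull.
Variables (R : realType) (n : nat) (s : seq 'rV[R]_n).

Lemma conv_seq_nth (i : 'I_(size s)) : conv_seq s s`_i.
Proof.
exists (fun j => (j == i)%:R); split; first by move=> j; rewrite ler0n.
split; first by rewrite (bigD1 i) //= eqxx big1 ?addr0 // => j /negPf->.
rewrite (bigD1 i) //= eqxx scale1r big1 ?addr0 // => j /negPf->.
by rewrite scale0r.
Qed.

Hypothesis s_gt0 : (0 < size s)%N.

Lemma conv_seq_max (c : 'cV[R]_n) :
  exists2 z, conv_seq s z & forall x, conv_seq s x -> (x *m c) 0 0 <= (z *m c) 0 0.
Proof.
pose i0 := Ordinal s_gt0.
case: (@arg_maxP _ _ _ i0 xpredT (fun i : 'I_(size s) => (s`_i *m c) 0 0)) => // i _ imax.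
exists s`_i; first exact: conv_seq_nth.
move=> x [w [w0 [w1 ->]]]; rewrite mulmx_suml summxE.
rewrite -[leRHS]mul1r -w1 mulr_suml; apply: ler_sum => j _.
by rewrite -scalemxAl mxE ler_wpM2l //; exact: imax.
Qed.

Lemma conv_seq_no_line x v : (forall t, conv_seq s (x + t *: v)) -> v = 0.
Proof.
move=> xv; apply/rowP => j; rewrite mxE; apply/eqP/negPn/negP => vj.
have [z _ zmax] := conv_seq_max (delta_mx j 0).
(* This [t] brings coordinate [j] to [z 0 j + 1], beyond its maximum. *)
have := zmax _ (xv ((z 0 j - x 0 j + 1) / v 0 j)).
by rewrite -!colE !mxE divfK //; lra.
Qed.

(** [hull_point] parametrises the affine hull by a full row space, in general redundantly, so that
    inequalities on a hull of any dimension become an affine system on ['rV_(size s)]. *)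
Definition hull_dirs : 'M[R]_(size s, n) := \matrix_i (s`_i - s`_0).
Definition hull_point (u : 'rV[R]_(size s)) : 'rV[R]_n := s`_0 + u *m hull_dirs.

Lemma hull_pointE u : hull_point u = s`_0 + \sum_i u 0 i *: (s`_i - s`_0).
Proof.
by rewrite /hull_point mulmx_sum_row; under eq_bigr do rewrite rowK.
Qed.

Lemma hull_point_affine u v (a b : R) :
  a + b = 1 -> hull_point (a *: u + b *: v) = a *: hull_point u + b *: hull_point v.
Proof.
move=> ab; rewrite /hull_point mulmxDl -!scalemxAl !scalerDr addrACA -scalerDl.
by rewrite ab scale1r.
Qed.

Lemma conv_seq_hull_point x : conv_seq s x -> exists u, x = hull_point u.
Proof.
move=> [w [_ [w1 ->]]]; exists (\row_i w i); rewrite hull_pointE.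
under [in RHS]eq_bigr do rewrite mxE scalerBr.
by rewrite sumrB -scaler_suml w1 scale1r addrC subrK.
Qed.

Lemma aff_hull_point u : aff (conv_seq s) (hull_point u).
Proof.
have [i0 i00] : exists i0 : 'I_(size s), i0 = 0%N :> nat by exists (Ordinal s_gt0).
exists (size s), (fun i => s`_i), (fun i => (i == i0)%:R * (1 - \sum_j u 0 j) + u 0 i).
split; first by move=> i; exact: conv_seq_nth.
have i0E : \sum_i ((i == i0)%:R : R) = 1.
  by rewrite (bigD1 i0) //= eqxx big1 ?addr0 // => j /negPf->.
split; first by rewrite big_split /= -mulr_suml i0E mul1r subrK.
have -> : \sum_(i < size s) ((i == i0)%:R * (1 - \sum_j u 0 j) + u 0 i) *: s`_i =
    (1 - \sum_j u 0 j) *: s`_i0 + \sum_(i < size s) u 0 i *: s`_i.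
  under eq_bigr do rewrite scalerDl; rewrite big_split /=; congr (_ + _).
  rewrite (bigD1 i0) //= eqxx mul1r [X in _ + X]big1 ?addr0 // => j /negPf->.
  by rewrite mul0r scale0r.
rewrite hull_pointE; under eq_bigr do rewrite scalerBr.
by rewrite i00 sumrB -scaler_suml scalerBl scale1r addrA addrAC.
Qed.

End ConvexHull.

(** Average witnesses one at a time: a midpoint is positive wherever one endpoint is, the [l i]
    being nonnegative on [X]. This supplies relative interior points. *)
Lemma positive_point (R : realFieldType) (N m : nat) (X : set 'rV[R]_N)
    (l : 'I_m -> 'rV[R]_N -> R) (A : {set 'I_m}) :
  (forall x y, X x -> X y -> X (2^-1 *: x + 2^-1 *: y)) ->
  (forall i x y, l i (2^-1 *: x + 2^-1 *: y) = 2^-1 * l i x + 2^-1 * l i y) ->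
  (forall i x, X x -> 0 <= l i x) -> (exists x, X x) ->
  (forall i, i \in A -> exists2 z, X z & 0 < l i z) ->
  exists2 y, X y & forall i, i \in A -> 0 < l i y.
Proof.
move=> Xmid lmid l0 [x Xx] lpos.
suff [y Xy yP] : exists2 y, X y & forall i, i \in enum A -> 0 < l i y.
  by exists y => // i iA; apply: yP; rewrite mem_enum.
have : forall i, i \in enum A -> exists2 z, X z & 0 < l i z.
  by move=> i; rewrite mem_enum; exact: lpos.
elim: (enum A) => [|i r IH] zP; first by exists x.
have [|y Xy yP] := IH; first by move=> j jr; apply: zP; rewrite inE jr orbT.
have [|z Xz zi] := zP i; first by rewrite inE eqxx.
exists (2^-1 *: y + 2^-1 *: z); first exact: Xmid.
move=> j; rewrite inE lmid => /orP[/eqP->|/yP jy].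
  by have := l0 i y Xy; lra.
by have := l0 j z Xz; lra.
Qed.

(** Take a minimal set [J] of indices whose inequalities imply all of them. A point showing that an
    index cannot be dropped violates, within [J], exactly that inequality. *)
Lemma irredundant_subsystem (R : realFieldType) (T : Type) (m : nat) (l : 'I_m -> T -> R) :
  exists m' (f : 'I_m' -> 'I_m),
    (forall u, (forall i, 0 <= l (f i) u) -> forall i, 0 <= l i u) /\
    (forall i, exists2 z, l (f i) z < 0 & forall j, j != i -> 0 <= l (f j) z).
Proof.
pose p (J : {set 'I_m}) :=
  `[< forall u, (forall i, i \in J -> 0 <= l i u) -> forall i, 0 <= l i u >].
have [|J Jmin] := @ex_minset _ p.
  by exists finset.setT; apply/asboolP => u h i; apply: h; rewrite inE.
have /asboolP JP := minsetp Jmin.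
exists #|J|, enum_val; split=> [u h|i].
  apply: JP => i iJ; have := h (enum_rank_in iJ i); by rewrite enum_rankK_in.
have : ~~ p (J :\ enum_val i)%SET.
  apply/negP => pJ; have /setP/(_ (enum_val i)) := minsetinf Jmin pJ (finset.subD1set _ _).
  by rewrite !inE eqxx enum_valP.
move/asboolPn => /existsNP[z /not_implyP[zJ nz]].
exists z.
  rewrite ltNge; apply/negP => zi; apply: nz; apply: JP => j jJ.
  have [->//|ji] := eqVneq j (enum_val i); by apply: zJ; rewrite !inE ji.
move=> j ji; apply: zJ; rewrite !inE enum_valP andbT.
by apply: contra_neq ji; exact: enum_val_inj.
Qed.

Section Faces.
Variables (R : realType) (n : nat) (P : set 'rV[R]_n).

Lemma face_self : face P P.
Proof.
have d0 x : dotv (0 : 'rV[R]_n) x = 0.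
  by rewrite /dotv big1 // => i _; rewrite mxE mul0r.
exists 0, 0; split; first by move=> x _; rewrite d0.
by apply/seteqP; split=> x; [move=> Px; split|case].
Qed.

Lemma face_coord (p : nat) (M : 'M[R]_(n, p)) (e : 'rV[R]_p) (i : 'I_p) :
  (forall x, P x -> 0 <= (x *m M + e) 0 i) ->
  face P [set x | P x /\ (x *m M + e) 0 i = 0].
Proof.
move=> P0; pose c : 'rV[R]_n := \row_a - M a i.
have cE x : dotv c x = - (x *m M) 0 i.
  rewrite /dotv mxE -sumrN; apply: eq_bigr => a _.
  by rewrite mxE mulNr mulrC.
exists c, (e 0 i); split=> [x /P0|]; first by rewrite mxE cE; lra.
by apply/seteqP; split=> x /= [Px]; rewrite [(_ + e) 0 i]mxE cE => h; split=> //; lra.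
Qed.

End Faces.

(** * The two implications *)

Section AffCapToProduct.
Variables (R : realType) (n : nat) (s : seq 'rV[R]_n).
Hypothesis s_gt0 : (0 < size s)%N.
Let P := conv_seq s.
Hypothesis aff_cap : forall (I : Type) (F : I -> set 'rV[R]_n),
  (forall i, face P (F i)) ->
  aff (\bigcap_(i in [set: I]) F i) = \bigcap_(i in [set: I]) aff (F i).

Variables (m : nat) (M : 'M[R]_(n, m)) (e : 'rV[R]_m).
Let C := hull_dirs s *m M.
Let d := s`_0 *m M + e.
Let l (i : 'I_m) (u : 'rV[R]_(size s)) : R := (u *m C + d) 0 i.

Hypothesis PE : forall u, P (hull_point u) <-> forall i, 0 <= l i u.
Hypothesis irredundant :
  forall i, exists2 z, l i z < 0 & forall j, j != i -> 0 <= l j z.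

Let lE i u : l i u = (hull_point u *m M + e) 0 i.
Proof. by rewrite /l /C /d /hull_point mulmxDl -mulmxA addrA [X in X + _]addrC. Qed.

Let l_aff i u v (a b : R) : a + b = 1 -> l i (a *: u + b *: v) = a * l i u + b * l i v.
Proof. exact: l_affine. Qed.

Let P_point x : P x -> exists2 u, x = hull_point u & forall i, 0 <= l i u.
Proof.
by move=> Px; have [u xE] := conv_seq_hull_point Px; exists u => //; apply/PE; rewrite -xE.
Qed.

Let feasible_nonempty : exists u, forall i, 0 <= l i u.
Proof. by have [u _ fu] := P_point (conv_seq_nth (Ordinal s_gt0)); exists u. Qed.

Let l_const_on_aff (X : set 'rV[R]_n) i (r : R) v :
  (forall u, X (hull_point u) -> l i u = r) -> X `<=` P ->
  aff X (hull_point v) -> l i v = r.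
Proof.
move=> Xr XP /(aff_coord (M := M) (j := i) (e := r - e 0 i)).
rewrite lE [(_ + e) 0 i]mxE => ->; first by rewrite subrK.
move=> y Xy; have [u yE _] := P_point (XP _ Xy).
by rewrite -(Xr u) -?yE // lE -yE [(_ + e) 0 i]mxE addrK.
Qed.

Let max_attained i : exists2 z, (forall j, 0 <= l j z) &
  forall u, (forall j, 0 <= l j u) -> l i u <= l i z.
Proof.
have [x Px xmax] := conv_seq_max s_gt0 (col i M).
have [z xE fz] := P_point Px; exists z => // u /PE Pu.
have := xmax _ Pu; rewrite !lE xE !colE !mulmxA -!colE.
by rewrite ![col _ _ _ _]mxE ![(_ + e) _ _]mxE lerD2r.
Qed.

(** Otherwise [l i] would vanish on the polytope, hence on its affine hull, against the negative
    value given by irredundancy. *)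
Let somewhere_pos i : exists2 z, (forall j, 0 <= l j z) & 0 < l i z.
Proof.
have [z zi _] := irredundant i; apply: contrapT => /forall2NP h.
suff li0 : l i z = 0 by rewrite li0 ltxx in zi.
apply: l_const_on_aff (aff_hull_point s_gt0 z); last by [].
move=> u /PE fu; have [//|/negP] := h u.
by rewrite -leNgt => li; apply/eqP; rewrite eq_le li fu.
Qed.

Let facet_set i : set 'rV[R]_n := [set x | P x /\ (x *m M + e) 0 i = 0].

(** With [w] in the relative interior of the facet, a point [q] of the facet slightly away from [w]
    towards [v] puts [v] on the line through [w] and [q]. *)
Let aff_facet i v : l i v = 0 -> aff (facet_set i) (hull_point v).
Proof.
move=> vi.
have [| | | | |y fy ypos] := @positive_point R _ _ [set u | forall j, 0 <= l j u] l finset.setT.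
- by move=> x y fx fy j; rewrite l_aff ?addr_ge0 ?mulr_ge0 ?invr_ge0 //; lra.
- by move=> j x y; rewrite l_aff //; lra.
- by move=> j x; apply.
- exact: feasible_nonempty.
- by move=> j _; exact: somewhere_pos.
have {}ypos j : 0 < l j y by apply: ypos; rewrite inE.
have [z zi zj] := irredundant i.
have D0 : 0 < l i y - l i z by have := ypos i; lra.
(* The segment from the interior point [y] to [z], which violates only inequality [i], crosses
   [l i = 0] at [w]. *)
pose w := (- l i z / (l i y - l i z)) *: y + (l i y / (l i y - l i z)) *: z.
have wE j : l j w = - l i z / (l i y - l i z) * l j y + l i y / (l i y - l i z) * l j z.
  by rewrite /w l_aff // -mulrDl addrC mulfV ?gt_eqF.
clearbody w.
have wi : l i w = 0 by rewrite wE; field; rewrite gt_eqF.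
have wj j : j != i -> 0 < l j w.
  move=> ji; rewrite wE ltr_pwDl ?mulr_gt0 ?invr_gt0 ?oppr_gt0 //.
  by rewrite !mulr_ge0 ?invr_ge0 ?zj ?ltW.
have [|t t0 tP] := @small_perturbation R m (l^~ w) (fun j => l j v - l j w).
  move=> j; have [->|/wj] := eqVneq j i; last by left.
  by right; rewrite wi vi subrr.
pose q := (1 - t) *: w + t *: v.
have qE j : l j q = l j w + t * (l j v - l j w) by rewrite /q l_aff ?subrK //; ring.
have facetP u : (forall j, 0 <= l j u) -> l i u = 0 -> facet_set i (hull_point u).
  by move=> /PE Pu ui; split=> //; rewrite -lE.
have -> : hull_point v = (1 - t^-1) *: hull_point w + t^-1 *: hull_point q.
  rewrite -hull_point_affine ?subrK //; congr hull_point.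
  rewrite /q scalerDr !scalerA addrA -scalerDl mulVf ?gt_eqF // scale1r.
  have -> : 1 - t^-1 + t^-1 * (1 - t) = 0 by field; rewrite gt_eqF.
  by rewrite scale0r add0r.
apply: aff_line; last by rewrite subrK.
  apply: facetP => // j; have [->|/wj/ltW//] := eqVneq j i; by rewrite wi.
by apply: facetP => [j|]; rewrite qE // wi vi subrr mulr0 addr0.
Qed.

(** [aff_cap] for the facets in [T], padded with the whole polytope; [None] keeps the intersection
    inside [P] even when there are no inequalities. *)
Let aff_faces (T : {set 'I_m}) v : (forall i, i \in T -> l i v = 0) ->
  aff [set x | P x /\ forall i, i \in T -> (x *m M + e) 0 i = 0] (hull_point v).
Proof.
move=> vT; pose F (o : option 'I_m) :=
  if o is Some i then if i \in T then facet_set i else P else P.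
have faceF o : face P (F o).
  case: o => [i|] /=; last exact: face_self.
  case: ifP => _; last exact: face_self.
  by apply: face_coord => x /P_point[u -> fu]; rewrite -lE.
have : (\bigcap_(o in [set: option 'I_m]) aff (F o)) (hull_point v).
  move=> [i|] _ /=; last exact: aff_hull_point.
  by case: ifP => [/vT/aff_facet//|_]; exact: aff_hull_point.
rewrite -aff_cap //; apply: aff_mono => x xF; split; first exact: (xF None).
by move=> i iT; have := xF (Some i) Logic.I; rewrite /= iT => -[].
Qed.

Lemma is_prod_simplices_of_irredundant : is_prod_simplices P.
Proof.
have [| |k [g [lam [gsurj lam0 lsum lsurj]]]] :=
    @simplex_coordinates R (size s) m C d irredundant _ _ max_attained somewhere_pos
      feasible_nonempty.
- move=> T v /aff_faces/aff_nonempty[x [/P_point[u -> fu] uT]].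
  by exists u => // i /uT; rewrite -lE.
- move=> T j v vT vj; apply: contrapT => h; case/negP: vj; apply/eqP.
  apply: l_const_on_aff (aff_faces vT); last by move=> x [].
  move=> u [/PE fu uT]; apply/eqP/negPn/negP => uj; apply: h; exists u.
  by split=> // i /uT; rewrite -lE.
(* Inverts [y i = lam i * l i u]: rescale, subtract [d], pull back along [C] by a pseudo-inverse. *)
pose A := diag_mx (\row_i (lam i)^-1) *m pinvmx C *m hull_dirs s.
pose b := s`_0 - d *m pinvmx C *m hull_dirs s.
pose inv y : 'rV[R]_(size s) := (y *m diag_mx (\row_i (lam i)^-1) - d) *m pinvmx C.
have invE y : y *m A + b = hull_point (inv y).
  rewrite /A /b /inv /hull_point !mulmxBl !mulmxA.
  by rewrite addrCA.
have invP y : simplex_prod g y -> forall i, lam i * l i (inv y) = y 0 i.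
  move=> [_ ysum]; have [u uP] := lsurj (fun i => y 0 i) ysum.
  have uE : y *m diag_mx (\row_i (lam i)^-1) - d = u *m C.
    apply/rowP => i; rewrite mul_mx_diag !mxE -uP /l [in X in X - _]mxE.
    by rewrite mulrAC mulfV ?gt_eqF // mul1r !mxE addrK.
  move=> i; rewrite -uP; congr (_ * _).
  by rewrite /l /inv uE mulmxKpV ?submxMl.
(* If all [l i] agree, the whole line through the two points is feasible; a bounded polytope
   contains no line. *)
have l_inj u v : (forall i, l i u = l i v) -> (forall i, 0 <= l i u) ->
    hull_point u = hull_point v.
  move=> uv u0; apply/eqP; rewrite -subr_eq0; apply/eqP.
  apply: (conv_seq_no_line s_gt0 (x := hull_point u)) => t.
  have -> : hull_point u + t *: (hull_point u - hull_point v) =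
      hull_point ((1 + t) *: u + (- t) *: v).
    by rewrite hull_point_affine ?addrK // scalerBr scalerDl scale1r scaleNr addrA.
  by apply/PE => i; rewrite l_aff ?addrK // -uv; have := u0 i; lra.
exists m, k, g; split=> //; exists A, b; split.
  move=> x y Qx Qy; rewrite !invE => xy; apply/rowP => i.
  by rewrite -invP // -[RHS]invP // !lE xy.
apply/seteqP; split=> [_ [y Qy <-]|x /P_point[u -> fu]].
  rewrite invE; apply/PE => i; rewrite -(pmulr_rge0 _ (lam0 i)) invP //.
  by case: Qy.
pose y : 'rV[R]_m := \row_i (lam i * l i u).
have Qy : simplex_prod g y.
  split=> [i|j]; first by rewrite mxE mulr_ge0 // ltW.
  by rewrite -[RHS](lsum u j); apply: eq_bigr => i _; rewrite mxE.
exists y => //; rewrite invE; apply/esym/l_inj => // i.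
by apply: (mulfI (lt0r_neq0 (lam0 i))); rewrite invP // mxE.
Qed.

End AffCapToProduct.

Lemma is_prod_simplices_of_aff_cap (R : realType) (n : nat) (s : seq 'rV[R]_n) :
  (0 < size s)%N ->
  (forall (I : Type) (F : I -> set 'rV[R]_n),
      (forall i, face (conv_seq s) (F i)) ->
      aff (\bigcap_(i in [set: I]) F i) = \bigcap_(i in [set: I]) aff (F i)) ->
  is_prod_simplices (conv_seq s).
Proof.
move=> s0 cap; have [m [M [e MP]]] := conv_seq_halfspaces s.
have [m' [f [fP irr]]] :=
  irredundant_subsystem (fun i u => (hull_point (s := s) u *m M + e) 0 i).
have fE i u : (u *m (hull_dirs s *m colsub f M) + (s`_0 *m colsub f M + colsub f e)) 0 i
    = (hull_point u *m M + e) 0 (f i).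
  rewrite /hull_point mulmxDl mulmxA addrA [X in X + _]addrC.
  by rewrite !mulmx_colsub !mxE.
apply: (@is_prod_simplices_of_irredundant _ _ _ s0 cap _ (colsub f M) (colsub f e)).
  move=> u; rewrite MP; split=> h; first by move=> i; rewrite fE.
  by apply: fP => i; rewrite -fE.
move=> i; have [z zi zj] := irr i; exists z; first by rewrite fE.
by move=> j /zj; rewrite fE.
Qed.

(** * Products of simplices have commuting hulls *)

Section ProductToAffCap.
Variables (R : realType) (n m k : nat) (g : 'I_m -> 'I_k).
Hypothesis g_surj : forall j, exists i, g i = j.
Variables (A : 'M[R]_(m, n)) (b : 'rV[R]_n).
Let Q : set 'rV[R]_m := simplex_prod g.
Let f (y : 'rV[R]_m) := y *m A + b.
Hypothesis f_inj : forall x y, Q x -> Q y -> f x = f y -> x = y.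

Let f_affine x y (a c : R) : a + c = 1 -> f (a *: x + c *: y) = a *: f x + c *: f y.
Proof.
by move=> ac; rewrite /f mulmxDl -!scalemxAl !scalerDr addrACA -scalerDl ac scale1r.
Qed.

Lemma simplex_prod_aff (x y : 'rV[R]_m) (a c : R) :
  (forall i, 0 <= a * x 0 i + c * y 0 i) -> a + c = 1 ->
  (forall j, \sum_(i | g i == j) x 0 i = 1) ->
  (forall j, \sum_(i | g i == j) y 0 i = 1) -> Q (a *: x + c *: y).
Proof.
move=> xy0 ac x1 y1; split=> [i|j]; first by rewrite !mxE.
under eq_bigr do rewrite !mxE.
by rewrite big_split -!mulr_sumr /= x1 y1 !mulr1.
Qed.

Lemma simplex_prod_interior (S : {set 'I_m}) :
  (forall j, exists2 i, g i = j & i \notin S) ->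
  exists2 w : 'rV[R]_m, Q w & forall i, (i \in S -> w 0 i = 0) /\ (i \notin S -> 0 < w 0 i).
Proof.
move=> gS; pose N j := #|[set i | (g i == j) && (i \notin S)]%SET|.
have N0 j : (0 < N j)%N.
  by have [i gi iS] := gS j; apply/card_gt0P; exists i; rewrite inE gi eqxx.
(* Uniform weight on the coordinates of each block outside [S]. *)
pose w : 'rV[R]_m := \row_i ((i \notin S)%:R / (N (g i))%:R).
have w0 i : i \notin S -> 0 < w 0 i.
  by move=> iS; rewrite mxE iS divr_gt0 // ltr0n.
have wS i : i \in S -> w 0 i = 0 by move=> iS; rewrite mxE iS mul0r.
exists w; last by move=> i; split; [exact: wS|exact: w0].
split=> [i|j].
  by have [/wS->|/w0/ltW] := boolP (i \in S).
rewrite (eq_bigr (fun i => (i \notin S)%:R * (N j)%:R^-1)); last first.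
  by move=> i /eqP gi; rewrite mxE gi.
rewrite -mulr_suml -natr_sum.
have -> : (\sum_(i | g i == j) (i \notin S : nat))%N = N j.
  rewrite /N -sum1dep_card [RHS]big_mkcondr.
  by apply: eq_bigr => i _; case: (i \notin S).
by rewrite mulfV // pnatr_eq0 -lt0n.
Qed.

(** Injectivity is given on [Q] only; adding a small multiple of [x - y] to an interior point [w] of
    [Q] transfers it to the hull. *)
Let f_inj_hull (x y : 'rV[R]_m) : (forall j, \sum_(i | g i == j) x 0 i = 1) ->
  (forall j, \sum_(i | g i == j) y 0 i = 1) -> f x = f y -> x = y.
Proof.
move=> x1 y1 fxy.
have [|w Qw wP] := @simplex_prod_interior finset.set0.
  by move=> j; have [i] := g_surj j; exists i; rewrite ?inE.
have [|t t0 tP] := @small_perturbation R m (fun i => w 0 i) (fun i => x 0 i - y 0 i).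
  by move=> i; left; apply: (wP i).2; rewrite inE.
pose z := w + t *: (x - y).
have Qz : Q z.
  split=> [i|j]; first by rewrite !mxE.
  under eq_bigr do rewrite !mxE.
  by rewrite big_split -mulr_sumr sumrB /= x1 y1 subrr mulr0 addr0; case: Qw.
have : z = w.
  apply: f_inj => //; rewrite /f /z mulmxDl -scalemxAl mulmxBl.
  by move/addIr: fxy => ->; rewrite subrr scaler0 addr0.
move/eqP; rewrite -subr_eq0 addrAC subrr add0r scaler_eq0 gt_eqF //=.
by rewrite subr_eq0 => /eqP.
Qed.

(** Incidence matrix that turns block sums into a matrix product, the form [aff_coord] handles. *)
Let blocks : 'M[R]_(m, k) := \matrix_(i, j) (g i == j)%:R.

Let blocksE (x : 'rV[R]_m) j : (x *m blocks) 0 j = \sum_(i | g i == j) x 0 i.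
Proof.
rewrite mxE [RHS]big_mkcond; apply: eq_bigr => i _.
by rewrite mxE; case: eqP; rewrite ?mulr1 ?mulr0.
Qed.

Lemma aff_cap_simplex_prod (I : Type) (F : I -> set 'rV[R]_n) :
  (forall i, face (f @` Q) (F i)) ->
  \bigcap_(i in [set: I]) aff (F i) `<=` aff (\bigcap_(i in [set: I]) F i).
Proof.
move=> faceF v vF.
(* An intersection over an empty index type is the whole space. *)
have [[i0]|noI] := pselect (inhabited I); last first.
  by apply: aff_sub => i _; case: noI; exists.
pose G i := [set y | Q y /\ F i (f y)].
have FG i : F i = f @` G i.
  have [c [r [_ FE]]] := faceF i; apply/seteqP; split=> [x Fx|_ [y [_ Fy] <-]//].
  move: (Fx); rewrite {1}FE => -[[y Qy yx] _]; exists y => //.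
  by split=> //; rewrite yx.
have /choice[y0 /all_and2[affG y0v]] : forall i, exists y, aff (G i) y /\ f y = v.
  by move=> i; have := vF i Logic.I; rewrite FG => /aff_image[y]; exists y.
have sumG i y : aff (G i) y -> forall j, \sum_(i | g i == j) y 0 i = 1.
  move=> Gy j; rewrite -blocksE; apply: aff_coord Gy => x [[_ x1] _].
  by rewrite blocksE.
pose y := y0 i0.
have Gy i : aff (G i) y.
  suff -> : y = y0 i by [].
  by apply: f_inj_hull (sumG _ _ (affG _)) (sumG _ _ (affG _)) _; rewrite !y0v.
have y1 := sumG _ _ (Gy i0).
(* Coordinates vanishing identically on at least one face; they vanish at [y], so no block lies
   inside [S]. *)
pose S := [set a | `[< exists i, forall x, G i x -> x 0 a = 0 >]]%SET.
have yS a : a \in S -> y 0 a = 0.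
  rewrite inE => /asboolP[i Gi].
  rewrite -[y]mulmx1; apply: aff_coord (Gy i) => x /Gi.
  by rewrite mulmx1.
have [|w Qw wP] := @simplex_prod_interior S.
  move=> j; apply: contrapT => /forall2NP h.
  have := y1 j; rewrite big1 => [/eqP|a /eqP ga]; first by rewrite eq_sym oner_eq0.
  by have [//|/negP/negPn/yS] := h a.
(* Vanishing coordinates determine a face: for [z] in its relative interior, the segment from [x]
   can be prolonged past [z] inside [Q], so the maximum of [dotv c] reached at [z] is also reached
   at [x]. *)
have inG i x : Q x -> (forall a, a \in S -> x 0 a = 0) -> G i x.
  move=> Qx xS; have [c [r [cr FE]]] := faceF i.
  have GE z : G i z <-> Q z /\ dotv c (f z) = r.
    by rewrite /G FE; split=> [[Qz [_ cz]]|[Qz cz]] //; split=> //; split=> //; exists z.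
  have dot_affine p q (a t : R) : a + t = 1 ->
      dotv c (f (a *: p + t *: q)) = a * dotv c (f p) + t * dotv c (f q).
    move=> at1; rewrite f_affine // /dotv !mulr_sumr -big_split /=.
    by apply: eq_bigr => j _; rewrite !mxE; ring.
  pose B := [set a | ~~ `[< forall z, G i z -> z 0 a = 0 >]]%SET.
  have half : 2^-1 + 2^-1 = 1 :> R by lra.
  have [| | | | |z Gz zpos] := @positive_point R m m (G i) (fun a z => z 0 a) B.
  - move=> p q /GE[[p0 p1] pr] /GE[[q0 q1] qr]; apply/GE; split.
      by apply: simplex_prod_aff => // a; rewrite addr_ge0 // mulr_ge0 // invr_ge0.
    by rewrite dot_affine // pr qr -mulrDl half mul1r.
  - by move=> a p q; rewrite !mxE.
  - by move=> a p [[p0 _] _].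
  - exact: aff_nonempty (Gy i).
  - move=> a; rewrite inE => /asboolPn/existsNP[p /not_implyP[Gp /eqP pa]].
    by exists p => //; rewrite lt_def pa; case: Gp => -[p0 _] _; exact: p0.
  have [Qz zr] := (GE z).1 Gz.
  have [|t t0 tP] := @small_perturbation R m (fun a => z 0 a) (fun a => z 0 a - x 0 a).
    move=> a; have [/zpos|] := boolP (a \in B); first by left.
    rewrite inE => /negPn/asboolP Ba; right.
    rewrite xS ?Ba ?subrr //.
    by rewrite inE; apply/asboolP; exists i.
  have Qq : Q ((1 + t) *: z + (- t) *: x).
    apply: simplex_prod_aff; rewrite ?addrK //; try by case: Qz; case: Qx.
    by move=> a; have := tP a; lra.
  have qr := cr _ (imageP f Qq).
  have xr := cr _ (imageP f Qx).
  apply/GE; split=> //; apply/eqP; rewrite eq_le xr /=.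
  by move: qr; rewrite dot_affine ?addrK // zr; nra.
have [|t t0 tP] := @small_perturbation R m (fun a => w 0 a) (fun a => y 0 a - w 0 a).
  move=> a; have [aS|/(wP a).2] := boolP (a \in S); last by left.
  by right; rewrite yS // (wP a).1 // subrr.
(* [w] and [q] both vanish on [S], so their images lie in every face, and [v] is on the line through
   these images. *)
pose q := (1 - t) *: w + t *: y.
have Qq : Q q.
  apply: simplex_prod_aff; rewrite ?subrK //; last by case: Qw.
  by move=> a; have := tP a; lra.
have -> : v = (1 - t^-1) *: f w + t^-1 *: f q.
  rewrite -f_affine ?subrK // -(y0v i0); congr f.
  rewrite /q scalerDr !scalerA addrA -scalerDl mulVf ?gt_eqF // scale1r.
  have -> : 1 - t^-1 + t^-1 * (1 - t) = 0 by field; rewrite gt_eqF.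
  by rewrite scale0r add0r.
apply: aff_line; last by rewrite subrK.
  by move=> i _; have [] : G i w by apply: inG => // a /(wP a).1.
move=> i _; have [] // : G i q; apply: inG => // a aS.
by rewrite !mxE (wP a).1 // yS // !mulr0 addr0.
Qed.

End ProductToAffCap.

Theorem theorem3 (R : realType) (n : nat) (P : set 'rV[R]_n) :
  polytope P -> P !=set0 ->
  (is_prod_simplices P <->
   (forall (I : Type) (F : I -> set 'rV[R]_n),
      (forall i, face P (F i)) ->
      aff (\bigcap_(i in [set: I]) F i) = \bigcap_(i in [set: I]) aff (F i))).
Proof.
move=> [s ->] [x0 Px0]; split.
  move=> [m [k [g [g_surj [A [b [f_inj <-]]]]]]] I F faceF; apply/seteqP; split.
    by move=> x Fx i _; apply: aff_mono Fx => y; apply.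
  exact: (aff_cap_simplex_prod g_surj f_inj faceF).
apply: is_prod_simplices_of_aff_cap.
case: s Px0 => [[w [_ [+ _]]]|//].
by rewrite big_ord0 => /eqP; rewrite eq_sym oner_eq0.
Qed.
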